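(* Let $(\mathcal{X},\Delta)$ be the input metric space, $\mathcal{Y}$ be the set of labels and $\mu_{XY}$ be the underlying joint probability distribution. Assume the marginal distribution of labels $\mu_Y$ is a uniform distribution over $\mathcal{Y}$. Consider the feature space $\mathcal{Z}$ and the set of downstream classifiers $\mathcal{H}=\{h:\mathcal{Z}\to\mathcal{Y}\}$. Given $\epsilon\ge0$, for any $g:\mathcal{X}\to\mathcal{Z}$, we have $$\inf_{h\in\mathcal{H}}\mathrm{AdvRisk}_\epsilon(h\circ g)\ \ge\ 1-\frac{\mathrm{I}(X;Z)-\mathrm{RV}_\epsilon(g)+\log 2}{\log|\mathcal{Y}|},$$ where $X$ is the random variable that follows the marginal distribution of inputs $\mu_X$ and $Z=g(X)$.
   Context: Spaces: $\mathcal{X}\subseteq\mathbb{R}^d$ is the input space with some distance metric $\Delta$, and $\mathcal{Z}\subseteq\mathbb{R}^n$ is the feature space. $|\mathcal{Y}|$ denotes the cardinality of the finite set $\mathcal{Y}$. Ball: $\mathcal{B}(\mathbf{x},\epsilon)=\{\mathbf{x}'\in\mathcal{X}:\Delta(\mathbf{x}',\mathbf{x})\le\epsilon\}$. Adversarial risk: for $f:\mathcal{X}\to\mathcal{Y}$, $\mathrm{AdvRisk}_\epsilon(f)=\Pr_{(\mathbf{x},y)\sim\mu_{XY}}[\exists\,\mathbf{x}'\in\mathcal{B}(\mathbf{x},\epsilon)\text{ s.t. }f(\mathbf{x}')\ne y]$. $\infty$-Wasserstein distance: $\mathrm{W}_\infty(\mu,\nu)=\lim_{p\to\infty}\mathrm{W}_p(\mu,\nu)$,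 where $\mathrm{W}_p$ is the $p$-th Wasserstein distance for the metric $\Delta$; alternatively, $\mathrm{W}_\infty(\mu,\nu)=\inf_{\gamma\in\Gamma(\mu,\nu)}\inf\{t\ge0:\gamma(\Delta(\mathbf{x},\mathbf{x}')>t)=0\}$, where $\Gamma(\mu,\nu)$ is the set of probability measures on $\mathcal{X}\times\mathcal{X}$ with marginals $\mu$ and $\nu$. The $\infty$-Wasserstein ball $\mathcal{B}_{\mathrm{W}_\infty}(\mu,\epsilon)$ is the set of probability measures $\mu'$ on $\mathcal{X}$ with $\mathrm{W}_\infty(\mu',\mu)\le\epsilon$. Mutual information: for random variables $(X,Z)$ with values in $\mathcal{X}\times\mathcal{Z}$, $\mathrm{I}(X;Z)=\int_{\mathcal{Z}}\int_{\mathcal{X}}p_{XZ}(\mathbf{x},\mathbf{z})\log\frac{p_{XZ}(\mathbf{x},\mathbf{z})}{p_X(\mathbf{x})p_Z(\mathbf{z})}\,d\mathbf{x}\,d\mathbf{z}$, where $p_{XZ}$ is the joint probability density function of $(X,Z)$ and $p_X,p_Z$ are the marginal probability density functions. Representation vulnerability: $\mathrm{RV}_\epsilon(g)=\sup_{\mu_{X'}\in\mathcal{B}_{\mathrm{W}_\infty}(\mu_X,\epsilon)}[\mathrm{I}(X;g(X))-\mathrm{I}(X';g(X'))]$, where $X\sim\mu_X$ and $X'\sim\mu_{X'}$.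
   Formalization: The formal statement assumes that the input space 𝒳 is a Borel subset of ℝ^d, that Δ is lower semicontinuous on 𝒳×𝒳 for the Euclidean topology, and that g is measurable; without the first two the claim can fail, since the W∞ infimum need not be attained. *)

(* Defs.v *)
From HB Require Import structures.
From mathcomp Require Import all_boot all_order all_algebra.
From mathcomp Require Import all_classical all_reals all_analysis.

Set Implicit Arguments.
Unset Strict Implicit.
Unset Printing Implicit Defensive.

Import Order.TTheory GRing.Theory Num.Theory.
Import numFieldNormedType.Exports.

Local Open Scope classical_set_scope.
Local Open Scope ring_scope.

(* R^d with its Borel sigma-algebra. *)
Notation borel_rV R d := (g_sigma_algebraType (@open 'rV[R]_d)).

(* Nonempty finite types; a measurableType has to be pointed. Nonemptiness is
   no restriction on a label set that carries a probability measure. *)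
#[short(type="pfinType")]
HB.structure Definition PointedFinite := {T of Finite T & Pointed T}.

(* A finite label set with the sigma-algebra of all its subsets. *)
Definition label_space (Y : pfinType) : Type := Y.

HB.instance Definition _ (Y : pfinType) := Pointed.on (label_space Y).
HB.instance Definition _ (Y : pfinType) :=
  @isMeasurable.Build default_measure_display (label_space Y)
    discrete_measurable discrete_measurable0
    discrete_measurableC discrete_measurableU.

Section measurable_maps.
Context {d d1 d2 : measure_display} {T : measurableType d}.
Context {T1 : measurableType d1} {T2 : measurableType d2}.

Definition mid (x : T) : T := x.
Definition mfst (p : T1 * T2) : T1 := p.1.
Definition msnd (p : T1 * T2) : T2 := p.2.
Definition mpair (f : {mfun T >-> T1}) (g : {mfun T >-> T2}) (x : T) : T1 * T2 :=
  (f x, g x).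

HB.instance Definition _ :=
  isMeasurableFun.Build _ _ _ _ mid (@measurable_id _ _ setT).
HB.instance Definition _ :=
  isMeasurableFun.Build _ _ _ _ mfst measurable_fst.
HB.instance Definition _ :=
  isMeasurableFun.Build _ _ _ _ msnd measurable_snd.

Let measurable_mpair (f : {mfun T >-> T1}) (g : {mfun T >-> T2}) :
  measurable_fun [set: T] (mpair f g).
Proof. exact: measurable_fun_pair. Qed.

HB.instance Definition _ (f : {mfun T >-> T1}) (g : {mfun T >-> T2}) :=
  isMeasurableFun.Build _ _ _ _ (mpair f g) (measurable_mpair f g).
End measurable_maps.

Section information.
Local Open Scope ereal_scope.
Local Open Scope charge_scope.

Definition KL_divergence {d : measure_display} {T : measurableType d}
    {R : realType} (P Q : probability T R) : \bar R :=
  if `[< P `<< Q >] then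
    \int[P]_x lne (('d (charge_of_finite_measure P) '/d Q) x)
  else +oo.

(* If (X, Z) has a density p_XZ with respect to some product of sigma-finite
   reference measures, with marginal densities p_X and p_Z, then
   p_XZ / (p_X p_Z) is the Radon-Nikodym derivative of the joint law with
   respect to the product of the marginal laws. The latter makes sense without
   reference measures, which is needed for Z = g(X): its joint law with X lives
   on a graph and in general has no density with respect to Lebesgue measure. *)
Definition mutual_information {d d1 d2 : measure_display}
    {T : measurableType d} {T1 : measurableType d1} {T2 : measurableType d2}
    {R : realType} (P : probability T R)
    (X : {RV P >-> T1}) (Z : {RV P >-> T2}) : \bar R :=
  KL_divergence (distribution P (mpair X Z))
    (distribution P X \x distribution P Z).

(* I(X; g(X)) for X of law mu. *)
Definition feature_information {d1 d2 : measure_display}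
    {T1 : measurableType d1} {T2 : measurableType d2} {R : realType}
    (mu : probability T1 R) (g : {mfun T1 >-> T2}) : \bar R :=
  mutual_information (P := mu) mid g.
End information.

(* The input space is a Borel set X of R^d. A probability measure on X is a
   Borel probability measure mu on R^d such that mu X = 1, and functions on X
   (such as the metric Delta) are total functions of which only the values on X
   matter. *)
Section input_space.
Context {R : realType} {d : nat}.
Variables (X : set 'rV[R]_d) (Delta : 'rV[R]_d -> 'rV[R]_d -> R).

Definition metric_on : Prop :=
  [/\ forall x y, X x -> X y -> 0 <= Delta x y,
      forall x y, X x -> X y -> (Delta x y = 0 <-> x = y),
      forall x y, X x -> X y -> Delta x y = Delta y x
    & forall x y z, X x -> X y -> X z -> Delta x z <= Delta x y + Delta y z].

(* Lower semicontinuity of Delta on X * X for the Euclidean topology, as usual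
   for a transport cost: it relates Delta to the sigma-algebra, so that the sets
   {Delta > t} are measurable and the infimum defining W_infty is attained. It
   holds for every metric that is continuous for the Euclidean topology. *)
Definition lsc_metric : Prop :=
  lower_semicontinuous
    (fun p : subspace (X `*` X) => (Delta p.1 p.2)%:E).

Definition input_ball (x : 'rV[R]_d) (eps : R) : set 'rV[R]_d :=
  [set x' | X x' /\ Delta x' x <= eps].

(* Even for measurable f the event below need not be Borel, so its probability
   is taken with the outer measure of mu; it is the usual value whenever the
   event is measurable for the completion of mu. *)
Definition adv_risk (Y : pfinType)
    (mu : probability (borel_rV R d * label_space Y)%type R)
    (eps : R) (f : 'rV[R]_d -> Y) : \bar R :=
  mu_ext mu [set p | exists2 x', input_ball p.1 eps x' & f x' <> p.2].

Definition coupling (mu nu : probability (borel_rV R d) R) :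
    set (probability (borel_rV R d * borel_rV R d)%type R) :=
  [set gamma |
    (forall A, measurable A -> distribution gamma mfst A = mu A) /\
    (forall A, measurable A -> distribution gamma msnd A = nu A)].

Definition W_infty (mu nu : probability (borel_rV R d) R) : \bar R :=
  ereal_inf [set ereal_inf [set t%:E | t in [set t : R | 0 <= t /\
      gamma [set p | [/\ X p.1, X p.2 & t < Delta p.1 p.2]] = 0%E]]
    | gamma in coupling mu nu].

Definition W_infty_ball (mu : probability (borel_rV R d) R) (eps : R) :
    set (probability (borel_rV R d) R) :=
  [set mu' : probability (borel_rV R d) R |
    mu' X = 1%E /\ (W_infty mu' mu <= eps%:E)%E].

(* The subtraction is that of \bar^d R, for which +oo - +oo = +oo. It is the
   ordinary one as soon as I(X; g(X)) is finite. *)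
Definition rep_vulnerability {d' : measure_display} {T : measurableType d'}
    (mu : probability (borel_rV R d) R) (eps : R)
    (g : {mfun borel_rV R d >-> T}) : \bar R :=
  ereal_sup [set (feature_information mu g - feature_information mu' g)%dE
            | mu' in W_infty_ball mu eps].

End input_space.

(* Main.v *)
Require Import Defs.
From HB Require Import structures.
From mathcomp Require Import all_boot all_order all_algebra.
From mathcomp Require Import all_classical all_reals all_analysis.
From mathcomp Require Import measurable_realfun ring lra.

(* Let X' have a law within W_infty-distance eps of that of X. Couple X' with X
   and carry the label Y along; conditioning on X' gives posteriors p_y(x').
   Where (X, Y) avoids the adversarial event, h(g(X')) = Y, so the label can be
   guessed from g(X') with success probability at least 1 - AdvRisk. Fano's
   inequality, obtained from the variational lower bound on the KL divergence,
   then bounds I(X'; g(X')) from below by (1 - AdvRisk) log |Y| - log 2, and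
   I(X; g(X)) - RV is the infimum of I(X'; g(X')) over the ball.

   The classifier h need not be measurable: compact inner approximation and
   Lusin's theorem replace its fibers by disjoint compact sets of features. No
   optimal coupling is used: couplings of cost eps + 1/k suffice, because the
   (eps + 1/k)-neighbourhoods of a compact set decrease to its
   eps-neighbourhood. *)

Set Implicit Arguments.
Unset Strict Implicit.
Unset Printing Implicit Defensive.

Import Order.TTheory GRing.Theory Num.Theory.
Import numFieldNormedType.Exports.

Local Open Scope classical_set_scope.
Local Open Scope ring_scope.

(** * Regularity of finite Borel measures on Euclidean space *)

(** Continuity from above, used each time a limiting set has to be replaced by a finite stage of a
    decreasing sequence. *)
Lemma near_measure_bigcap_lt d (T : measurableType d) (R : realType)
    (m : {finite_measure set T -> \bar R}) (F : nat -> set T) (e : \bar R) :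
  (forall n, measurable (F n)) ->
  (forall n p, (n <= p)%N -> F p `<=` F n) ->
  (m (\bigcap_n F n) < e)%E -> \forall n \near \oo, (m (F n) < e)%E.
Proof.
move=> mF niF lte.
have nF : {homo F : n p / (n <= p)%N >-> (p <= n)%O}.
  by move=> n p np; rewrite subsetEset; exact: niF.
have Foo : (m (F 0%N) < +oo)%E by rewrite ltey_eq fin_num_measure.
have mI : measurable (\bigcap_n F n) by exact: bigcapT_measurable.
have lteN : nbhs (m (\bigcap_n F n)) [set x | (x < e)%E].
  by apply: open_nbhs_nbhs; split => //; exact: open_ereal_lt_ereal.
exact: (nonincreasing_cvg_mu Foo mF mI nF lteN).
Qed.

Lemma measure_bigcup_le_expn d (T : measurableType d) (R : realType)
    (m : {measure set T -> \bar R}) (F : nat -> set T) (e : R) : 0 <= e ->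
  (forall n, measurable (F n)) ->
  (forall n, (m (F n) <= (e / (2 ^ n.+1)%:R)%:E)%E) ->
  (m (\bigcup_n F n) <= e%:E)%E.
Proof.
move=> e0 mF Fe; have mU : measurable (\bigcup_n F n) by exact: bigcupT_measurable.
apply: (le_trans (measure_sigma_subadditive m mF mU (@subset_refl _ _))).
have := @epsilon_trick R (fun=> 0%E) e xpredT (fun=> lexx _) e0.
rewrite [X in (_ <= X + _)%E]eseries0// add0e; apply: le_trans.
by apply: lee_nneseries => // i _; rewrite add0e.
Qed.

(** Second countability: balls with rational centres and radii [1/(k+1)], enumerated through
    [unpickle]; codes that decode to nothing give the empty set. *)
Lemma rV_basis_seq (R : realType) n : exists V : nat -> set 'rV[R]_n,
  (forall k, open (V k)) /\
  forall x U, nbhs x U -> exists2 k, V k x & V k `<=` U.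
Proof.
pose B (p : 'rV[rat]_n * nat) : set 'rV[R]_n :=
  ball (map_mx (ratr : rat -> R) p.1 : 'rV[R]_n) p.2.+1%:R^-1.
exists (fun k => if unpickle k is Some p then B p else set0); split.
  by move=> k; case: unpickle => [p|]; [exact: ball_open|exact: open0].
move=> x U /nbhs_ballP[e /= e0 eU].
have [k ke] : exists k : nat, k.+1%:R^-1 < e / 2.
  have e20 : 0 < e / 2 by rewrite divr_gt0.
  by have [k _ /(_ k (leqnn k)) ?] := near_infty_natSinv_lt (PosNum e20); exists k.
have /choice[q qx] : forall i, exists q : rat,
    ratr q \in `]x ord0 i - k.+1%:R^-1, x ord0 i + k.+1%:R^-1[.
  by move=> i; apply: rat_in_itvoo; rewrite ltrD2l (@lt_trans _ _ 0)//
    ?oppr_lt0 invr_gt0.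
have qB : ball (map_mx (ratr : rat -> R) (\row_i q i) : 'rV[R]_n) k.+1%:R^-1 x.
  split=> [|i j]; first by rewrite invr_gt0.
  rewrite !mxE (ord1 i); have := qx j.
  by rewrite in_itv/= /ball/= distrC ltr_distlC.
exists (pickle (\row_i q i, k)); rewrite pickleK//.
move=> y By; apply: eU; apply: (le_ball (ltW _) (ball_triangle (ball_sym qB) By)).
by rewrite (splitr e) ltrD.
Qed.

Lemma open_measurable_rV (R : realType) n (A : set 'rV[R]_n) :
  open A -> measurable (A : set (borel_rV R n)).
Proof. by move=> oA; exact: sub_sigma_algebra. Qed.

Lemma closed_measurable_rV (R : realType) n (A : set 'rV[R]_n) :
  closed A -> measurable (A : set (borel_rV R n)).
Proof.
move=> cA; rewrite -[A]setCK; apply: (@measurableC _ (borel_rV R n)).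
by apply: open_measurable_rV; exact: closed_openC.
Qed.

Section regularity.
Context {R : realType} {n : nat}.
Variable m : {finite_measure set (borel_rV R n) -> \bar R}.

(** Approximation from inside and outside at once makes the property stable under complements, which
    exchange [F] and [U]. *)
Definition regular_set (A : set 'rV[R]_n) := forall e : R, 0 < e ->
  exists F U : set 'rV[R]_n, [/\ closed F, open U, F `<=` A, A `<=` U &
    (m (U `\` F) < e%:E)%E].

Lemma regular_set_open (A : set 'rV[R]_n) : open A -> regular_set A.
Proof.
move=> oA e e0.
(* [G k] is an open neighbourhood of the complement of [A]. Since [A] is open, the sets [A] meet
   [G k] shrink to the empty set, and the complement of [G k] serves as [F]. *)
pose G k : set 'rV[R]_n := \bigcup_(x in ~` A) ball x k.+1%:R^-1.
have oG k : open (G k) by apply: bigcup_open => x _; exact: ball_open.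
have niG k p : (k <= p)%N -> G p `<=` G k.
  move=> kp y [x Ax xy]; exists x => //; apply: le_ball xy.
  by rewrite lef_pV2 ?posrE// ler_nat ltnS.
have AG : \bigcap_k (A `&` G k) = set0.
  apply/seteqP; split => // y Gy; have [Ay _] := Gy 0%N I.
  have /nbhs_ballP[r /= r0 rA] : nbhs y A by exact: open_nbhs_nbhs.
  have [k _ /(_ k (leqnn k)) kr] := near_infty_natSinv_lt (PosNum r0).
  have [_ [x Ax xy]] := Gy k I; apply: Ax; apply: rA.
  exact: (le_ball (ltW kr) (ball_sym xy)).
have [|||k _ /(_ k (leqnn k)) ke] :=
  @near_measure_bigcap_lt _ _ _ m (fun k => A `&` G k) e%:E.
- by move=> k; apply: measurableI; exact: open_measurable_rV.
- by move=> k p kp; apply: setIS; exact: niG.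
- by rewrite AG measure0 lte_fin.
exists (~` G k), A; split => //.
- exact: open_closedC.
- by move=> y Gy; apply: contrapT => Ay; apply: Gy; exists y => //; exact: ballxx.
- by rewrite setDE setCK.
Qed.

(** The regular sets form a sigma-algebra that contains the open sets. *)
Lemma regular_set_measurable (A : set (borel_rV R n)) :
  measurable A -> regular_set A.
Proof.
apply: smallest_sub => [|U openU]; last exact: regular_set_open.
split.
- exact/regular_set_open/open0.
- move=> B rB e e0; have [F [U [cF openU FB BO le]]] := rB e e0.
  exists (~` U), (~` F); split.
  + exact: open_closedC.
  + exact: closed_openC.
  + by rewrite setTD; exact: subsetC.
  + by rewrite setTD; exact: subsetC.
  + by rewrite setDE setCK setIC -setDE.
- move=> B rB e e0.
  have e2 i : 0 < (e / 2) / (2 ^ i.+1)%:R by rewrite !divr_gt0// ltr0n expn_gt0.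
  have /choice[F /choice[U FO]] i := rB i _ (e2 i).
  have mF i : measurable (F i : set (borel_rV R n)).
    by have [? _ _ _ _] := FO i; exact: closed_measurable_rV.
  have openU i : open (U i) by have [_ ? _ _ _] := FO i.
  have mO i : measurable (U i : set (borel_rV R n)) by exact: open_measurable_rV.
  (* Only finite unions of the [F i] are sure to be closed, so the union is cut at some [N]; the
     error [G N] decreases to a set covered by the [U i] minus [F i], of total mass at most
     [e / 2]. *)
  pose G N := \bigcup_i U i `\` \bigcup_(i < N) F i.
  have mG N : measurable (G N : set (borel_rV R n)).
    by apply: measurableD; [exact: bigcupT_measurable|exact: bigcup_measurable].
  have niG k p : (k <= p)%N -> G p `<=` G k.
    move=> kp; apply: setDS; apply: bigcup_sub => i /= ik x Fx.
    by exists i => //=; exact: leq_trans kp.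
  have GE : \bigcap_N G N `<=` \bigcup_i (U i `\` F i).
    move=> x Gx; have [[i _ Ox] _] := Gx 0%N I; exists i => //; split => // Fx.
    by have [_ H] := Gx i.+1 I; apply: H; exists i => /=.
  have Ge : (m (\bigcap_N G N) < e%:E)%E.
    apply: (@le_lt_trans _ _ (e / 2)%:E); last first.
      by rewrite lte_fin ltr_pdivrMr// ltr_pMr// ltr1n.
    have mD i : measurable ((U i `\` F i) : set (borel_rV R n)) by exact: measurableD.
    apply: (@le_trans _ _ (m (\bigcup_i (U i `\` F i)))).
      apply: le_measure; rewrite ?inE//.
        exact: bigcapT_measurable.
      exact: bigcupT_measurable.
    apply: measure_bigcup_le_expn => // [|i]; first by rewrite divr_ge0// ltW.
    by apply: ltW; have [_ _ _ _] := FO i.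
  have [N _ /(_ N (leqnn N)) GN] := near_measure_bigcap_lt mG niG Ge.
  exists (\bigcup_(i < N) F i), (\bigcup_i U i); split => //.
  + by apply: closed_bigcup => // i _; have [] := FO i.
  + exact: bigcup_open.
  + by move=> x [i _ Fx]; exists i => //; have [_ _ + _ _] := FO i; exact.
  + by move=> x [i _ Fx]; exists i => //; have [_ _ _ + _] := FO i; exact.
Qed.

(** A closed inner approximation is cut by a large closed ball [B k], outside which the finite
    measure [m] is small; closed bounded sets are compact here. *)
Lemma compact_inner (A : set (borel_rV R n)) (e : R) : measurable A -> 0 < e ->
  exists K : set 'rV[R]_n, [/\ compact K, K `<=` A & (m (A `\` K) < e%:E)%E].
Proof.
move=> mA e0; have e2 : 0 < e / 2 by rewrite divr_gt0.
have [F [U [cF openU FA AO mOF]]] := regular_set_measurable mA e2.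
pose B k : set 'rV[R]_n := [set x | `|x| <= k%:R].
have cB k : closed (B k).
  apply: (@closed_comp _ _ (fun x : 'rV[R]_n => `|x|) [set x | x <= k%:R]).
    by move=> x _; exact: norm_continuous.
  exact: closed_le.
have mB k : measurable (B k : set (borel_rV R n)) by exact: closed_measurable_rV.
have B0 : \bigcap_k ~` B k = set0.
  apply/seteqP; split => // x Bx; apply: (Bx (Num.truncn `|x|).+1 I).
  by rewrite /B/= ltW// truncnS_gt.
have [|||k _ /(_ k (leqnn k)) Bk] :=
  @near_measure_bigcap_lt _ _ _ m (fun k => ~` B k) (e / 2)%:E.
- by move=> k; exact: measurableC.
- by move=> k p kp; apply: subsetC => x /le_trans; apply; rewrite ler_nat.
- by rewrite B0 measure0 lte_fin.
exists (F `&` B k); split.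
- apply: bounded_closed_compact; last exact: closedI.
  by exists k%:R; split => // M kM x [_ Bx]; exact: le_trans Bx (ltW kM).
- by move=> x [/FA].
- have mF := closed_measurable_rV cF; have mO := open_measurable_rV openU.
  apply: (@le_lt_trans _ _ (m ((U `\` F) `|` ~` B k))).
    apply: le_measure; rewrite ?inE.
    + by apply: measurableD => //; exact: measurableI.
    + by apply: measurableU; [exact: measurableD|exact: measurableC].
    + move=> x [Ax FB]; have [Fx|Fx] := pselect (F x); last by left; split => //; exact: AO.
      by right => Bx; apply: FB.
  apply: (@le_lt_trans _ _ (m (U `\` F) + m (~` B k))%E).
    by apply: measureU2; [exact: measurableD|exact: measurableC].
  by rewrite (splitr e) EFinD lteD.
Qed.

(* Lusin's argument: off a small open set, the preimages of the members of a
   countable basis are relatively open. *)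
Lemma compact_image_inner k (g : 'rV[R]_n -> 'rV[R]_k) (A : set (borel_rV R n))
    (e : R) :
  measurable_fun setT (g : borel_rV R n -> borel_rV R k) ->
  measurable A -> 0 < e ->
  exists K : set 'rV[R]_n, [/\ compact K, K `<=` A, compact (g @` K) &
    (m (A `\` K) < e%:E)%E].
Proof.
move=> mg mA e0; have e2 : 0 < e / 2 by rewrite divr_gt0.
have [V [openV basisV]] := rV_basis_seq R k.
have mV i : measurable (g @^-1` (V i) : set (borel_rV R n)).
  by have := mg measurableT (V i) (open_measurable_rV (openV i)); rewrite setTI.
have e2i i : 0 < (e / 2) / (2 ^ i.+1)%:R by rewrite !divr_gt0// ltr0n expn_gt0.
have /choice[F /choice[U FU]] i := regular_set_measurable (mV i) (e2i i).
(* Since [F i] lies in the preimage of [V i], which lies in [U i], all three sets coincide off [N];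
   hence [g] restricted to the complement of [N] is continuous. *)
pose N := \bigcup_i (U i `\` F i).
have oN : open N.
  apply: bigcup_open => i _; have [cF openU _ _ _] := FU i.
  by apply: openI => //; exact: closed_openC.
have [K0 [cK0 K0A mK0]] := compact_inner mA e2.
have cK : compact (K0 `&` ~` N) by apply: compact_closedI => //; exact: open_closedC.
exists (K0 `&` ~` N); split => //.
- by move=> x [/K0A].
- apply: continuous_compact => //; apply/subspace_continuousP => x [_ Nx] W.
  move=> /basisV[i Vgx VW]; have [_ openU FV VU _] := FU i.
  have UxU : nbhs x (U i) by apply: open_nbhs_nbhs; split => //; exact: VU.
  apply: (filterS _ UxU : nbhs x [set y | (K0 `&` ~` N) y -> W (g y)]) => y Uy [_ Ny].
  by apply: VW; apply: FV; apply: contrapT => Fy; apply: Ny; exists i.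
- apply: (@le_lt_trans _ _ (m (A `\` K0) + m N)%E).
    apply: (@le_trans _ _ (m ((A `\` K0) `|` N))); last first.
      apply: measureU2; last exact: open_measurable_rV.
      apply: measurableD => //; apply: closed_measurable_rV.
      exact: compact_closed.
    apply: le_measure; rewrite ?inE.
    + apply: measurableD => //; apply: closed_measurable_rV; exact: compact_closed.
    + apply: measurableU; last exact: open_measurable_rV.
      apply: measurableD => //; apply: closed_measurable_rV; exact: compact_closed.
    + move=> x [Ax KNx]; have [Nx|Nx] := pselect (N x); [by right|left].
      by split => // Kx; apply: KNx.
  rewrite (splitr e) EFinD; apply: lte_leD => //.
    by rewrite fin_num_measure//; exact: open_measurable_rV.
  apply: measure_bigcup_le_expn => [|i|i]; first exact: ltW.
  + have [cF openU _ _ _] := FU i.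
    by apply: measurableD; [exact: open_measurable_rV|exact: closed_measurable_rV].
  + by apply: ltW; have [] := FU i.
Qed.
End regularity.

(** * Measurability for lower semicontinuous metrics, and neighbourhoods of compact sets *)

Lemma measurable_lsc_sublevel_compl (R : realType) d (X : set 'rV[R]_d)
    (Delta : 'rV[R]_d -> 'rV[R]_d -> R) (t : R) :
  measurable (X : set (borel_rV R d)) -> lsc_metric X Delta ->
  measurable ([set p | [/\ X p.1, X p.2 & t < Delta p.1 p.2]]
    : set (borel_rV R d * borel_rV R d)).
Proof.
move=> mX lscD; have [V [openV basisV]] := rV_basis_seq R d.
(* The set is relatively open in [X * X]. The product sigma-algebra is generated by rectangles, so
   it is written as a countable union of basic rectangles on which [Delta] exceeds [t]. *)
pose P (p : nat * nat) := forall x y, V p.1 x -> V p.2 y -> X x -> X y -> t < Delta x y.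
pose W (p : nat * nat) : set (borel_rV R d * borel_rV R d) :=
  if `[< P p >] then V p.1 `*` V p.2 else set0.
have -> : [set p | [/\ X p.1, X p.2 & t < Delta p.1 p.2]] = (X `*` X) `&` \bigcup_p W p.
  apply/seteqP; split => [[x y] /= [Xx Xy txy]|[x y] /= [[Xx Xy] [p _]]]; last first.
    by rewrite /W; case: asboolP => // Pp [Vx Vy]; split => //; exact: Pp.
  split => //; have [S nS St] := lscD (x, y) t txy.
  have : within (X `*` X) (nbhs (x, y)) S.
    by rewrite (nbhs_subspace_in (conj Xx Xy : (X `*` X) (x, y))).
  move=> [[/= S1 S2] [nS1 nS2] S12].
  have [i Vx VS1] := basisV _ _ nS1; have [j Vy VS2] := basisV _ _ nS2.
  exists (i, j) => //; rewrite /W; case: asboolP => // -[] x' y' Vx' Vy' Xx' Xy'.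
  have /(_ (conj Xx' Xy')) Sxy := S12 (x', y') (conj (VS1 _ Vx') (VS2 _ Vy')).
  by have := St _ Sxy; rewrite lte_fin.
apply: measurableI; first exact: measurableX.
apply: countable_bigcupT_measurable => [|p]; first exact: countableP.
rewrite /W; case: asboolP => // _.
by apply: measurableX; exact: open_measurable_rV.
Qed.

Section sublevel.
Context {R : realType} {d : nat}.
Variables (X C : set 'rV[R]_d) (Delta : 'rV[R]_d -> 'rV[R]_d -> R).
Hypotheses (lscD : lsc_metric X Delta) (cC : compact C) (CX : C `<=` X).

(** The union of the balls [input_ball X Delta x t] for [x] in [C]. *)
Definition thickening (t : R) : set 'rV[R]_d :=
  [set z | X z /\ exists2 x, C x & Delta z x <= t].

(** A tube argument. Around each [x] of [C], semicontinuity keeps [Delta] above the midpoint of [t]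
    and [Delta z x]; compactness of [C] makes the neighbourhood of [z] and the level [s] uniform in
    [x]. *)
Lemma near_thickening_compl z t : X z -> ~ thickening t z ->
  exists2 s, t < s & nbhs z (~` thickening s).
Proof.
move=> Xz Cz; have tD x : C x -> t < Delta z x.
  by move=> Cx; rewrite ltNge; apply/negP => zx; apply: Cz; split => //; exists x.
have [|[A B] /= [zA tB] AB] := (iffLR (compact_near_coveringP C) cC)
    ('rV[R]_d * R)%type (filter_prod (nbhs z) (nbhs t^'+))
    (fun i x => X i.1 -> X x -> i.2 < Delta i.1 x) _.
  move=> x Cx; have tzx := tD _ Cx.
  have [S nS St] := @lscD (z, x) ((t + Delta z x) / 2) (midf_lt tzx).2.
  have : within (X `*` X) (nbhs (z, x)) S.
    by rewrite (nbhs_subspace_in (conj Xz (CX Cx) : (X `*` X) (z, x))).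
  move=> [[/= S1 S2] [nS1 nS2] S12].
  exists (S2, S1 `*` [set s | s < (t + Delta z x) / 2]).
    split => //=; exists (S1, [set s | s < (t + Delta z x) / 2]) => //.
    by split => //=; apply: nbhs_right_lt; exact: (midf_lt tzx).1.
  move=> [y [y' s]] /= [S2y [S1y' sr]] Xy' Xy.
  have /(_ (conj Xy' Xy)) /St := S12 (y', y) (conj S1y' S2y).
  by rewrite lte_fin; exact: lt_trans.
have : exists2 s, t < s & B s.
  have [s [ts Bs]] : exists s, t < s /\ B s.
    apply: (@filter_ex _ (nbhs t^'+)); apply: filterI tB; exact: nbhs_right_gt.
  by exists s.
move=> [s ts Bs]; exists s => //; apply: filterS zA => y Ay [Xy [x Cx]].
by apply/negP; rewrite -ltNge; apply: (AB (y, s)) => //; exact: CX.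
Qed.

Lemma measurable_thickening t : measurable (X : set (borel_rV R d)) ->
  measurable (thickening t : set (borel_rV R d)).
Proof.
(* The thickening is relatively closed in [X]. *)
move=> mX; have -> : thickening t = X `\` (~` thickening t)^°.
  apply/seteqP; split => z.
    by move=> Tz; split; [case: Tz|move=> /interior_subset].
  move=> [Xz Iz]; apply: contrapT => Tz; apply: Iz.
  have [s ts] := near_thickening_compl Xz Tz; apply: filterS => y Ty [Xy [x Cx yx]].
  by apply: Ty; split => //; exists x => //; rewrite (le_trans yx)// ltW.
apply: measurableD => //; apply: open_measurable_rV; exact: open_interior.
Qed.

Lemma bigcap_thickening t :
  \bigcap_k thickening (t + k.+1%:R^-1) `<=` thickening t.
Proof.
move=> z Tz; apply: contrapT => nTz; have [Xz _] := Tz 0%N I.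
have [s ts /nbhs_singleton] := near_thickening_compl Xz nTz; apply.
have st : 0 < s - t by rewrite subr_gt0.
have [k _ /(_ k (leqnn k)) ks] := near_infty_natSinv_lt (PosNum st).
have [_ [x Cx zx]] := Tz k I; split => //; exists x => //.
by rewrite (le_trans zx)// -lerBrDl ltW.
Qed.
End sublevel.

(** * A variational lower bound on the Kullback-Leibler divergence *)

Section KL_lower_bound.
Local Open Scope ereal_scope.
Context d (T : measurableType d) (R : realType).

(** No integrability is assumed: the positive and negative parts are compared separately. *)
Lemma le_integralT (mu : measure T R) (f g : T -> \bar R) :
  measurable_fun setT f -> measurable_fun setT g -> (forall x, f x <= g x) ->
  \int[mu]_x f x <= \int[mu]_x g x.
Proof.
move=> mf mg fg; rewrite [leLHS]integralE [leRHS]integralE; apply: leeB.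
- apply: ge0_le_integral => //; [exact: measurable_funepos..|].
  by move=> x _; rewrite funeposE funeposE ge_max le_max fg le_max lexx orbT.
- apply: ge0_le_integral => //; [exact: measurable_funeneg..|].
  by move=> x _; rewrite !funenegE ge_max !le_max leeN2 fg lexx orbT.
Qed.

Lemma measurable_set_ler (f g : T -> R) :
  measurable_fun setT f -> measurable_fun setT g ->
  measurable [set x | (f x <= g x)%R].
Proof.
move=> mf mg; have mle := measurable_fun_ler mf mg.
rewrite -[X in measurable X]setTI.
have -> : [set x | (f x <= g x)%R] = (fun x => (f x <= g x)%R) @^-1` [set true].
  by apply/seteqP; split.
exact: mle.
Qed.

Lemma measurable_lne_fin (f : T -> R) : measurable_fun setT f ->
  measurable_fun setT (fun x => lne (f x)%:E).
Proof.
move=> mf; apply: measurable_fun_ifT => //.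
  exact: measurable_fun_ler.
by apply/measurable_EFinP; apply: measurableT_comp mf; exact: measurable_ln.
Qed.

(* Gibbs' variational principle; with [f] the density of [P] with respect to
   [Q], it integrates the inequality [ln f >= phi + 1 - expR phi / f]. *)
Lemma KL_divergence_ge (P Q : probability T R) (phi : T -> R) :
  measurable_fun setT phi -> [bounded phi x | x in [set: T]] ->
  \int[Q]_x (expR (phi x))%:E < +oo ->
  \int[P]_x (phi x)%:E + 1 - \int[Q]_x (expR (phi x))%:E <= KL_divergence P Q.
Proof.
move=> mphi bphi Qphi; rewrite /KL_divergence.
case: asboolP => [PQ|_]; last exact: leey.
(* This version of the density is finite and nonnegative everywhere; it agrees with the derivative
   in [KL_divergence] almost everywhere for [Q], hence for [P]. *)
pose F := Radon_Nikodym_SigmaFinite.f P Q.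
have F0 x : 0 <= F x by exact: Radon_Nikodym_SigmaFinite.f_ge0.
have Ffin x : F x \is a fin_num by exact: Radon_Nikodym_SigmaFinite.f_fin_num.
have mF : measurable_fun setT F.
  exact: measurable_int (Radon_Nikodym_SigmaFinite.f_integrable PQ).
pose f x := fine (F x).
have mf : measurable_fun setT f by exact: measurableT_comp.
have fE x : F x = (f x)%:E by rewrite fineK.
have f0 x : (0 <= f x)%R by rewrite -lee_fin -fE.
have mlnf : measurable_fun setT (fun x => ln (f x)).
  by apply: measurableT_comp mf; exact: measurable_ln.
(* This is [expR phi / f] where [f] is positive. Where [f] vanishes, [ln] takes its default value 0
   and [w] is [expR phi], harmless because [w * f] is 0 there. *)
pose w x := expR (phi x - ln (f x))%R.
have mw : measurable_fun setT w.
  by apply: measurableT_comp; [exact: measurable_expR|exact: measurable_funB].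
(* [P] does not charge the zeros of its density, the only points where [lne] and [ln] of [f]
   differ. *)
have fpos : {ae P, forall x, (0 < f x)%R}.
  exists [set x | (f x <= 0)%R]; split.
  - exact: measurable_set_ler.
  - rewrite (Radon_Nikodym_SigmaFinite.f_integral PQ).
      apply: integral0_eq => x /= fx0; rewrite -/(F x) fE; congr (_%:E).
      by apply/eqP; rewrite eq_le fx0 f0.
    exact: measurable_set_ler.
  - by move=> x /= /negP; rewrite -leNgt.
have FRN : {ae P, forall x, Radon_Nikodym (charge_of_finite_measure P) Q x = F x}.
  have := null_dominates_ae_eq measurableT PQ
    (ae_eq_Radon_Nikodym_SigmaFinite PQ measurableT).
  by apply: filterS => x /(_ I).
have -> : \int[P]_x lne (Radon_Nikodym (charge_of_finite_measure P) Q x) =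
    \int[P]_x (ln (f x))%:E.
  apply: ae_eq_integral => //.
  - have RNfin x : Radon_Nikodym (charge_of_finite_measure P) Q x \is a fin_num.
      exact: Radon_Nikodym_fin_num.
    rewrite (_ : (fun x => _) = fun x =>
        lne (fine (Radon_Nikodym (charge_of_finite_measure P) Q x))%:E).
      apply: measurable_lne_fin; apply: measurableT_comp => //.
    by apply/funext => x; rewrite fineK.
  - exact/measurable_EFinP.
  - by apply: filterS2 FRN fpos => x -> fx _; rewrite fE /lne leNgt fx.
(* Only an inequality: the part of [Q] on the zeros of [f] is lost. *)
have Pw : \int[P]_x (w x)%:E <= \int[Q]_x (expR (phi x))%:E.
  rewrite -(Radon_Nikodym_SigmaFinite.change_of_variables PQ)//;
    last exact/measurable_EFinP.
  - apply: ge0_le_integral => //.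
    + by move=> x _; rewrite mule_ge0// ?lee_fin ?expR_ge0 ?F0.
    + by apply: emeasurable_funM => //; exact/measurable_EFinP.
    + by apply/measurable_EFinP; apply: measurableT_comp => //; exact: measurable_expR.
    + move=> x _; rewrite -/(F x) fE -EFinM lee_fin /w.
      have := f0 x; rewrite le_eqVlt => /predU1P[<-|fx]; first by rewrite mulr0 expR_ge0.
      by rewrite expRB lnK ?posrE// -mulrA mulVf ?mulr1// gt_eqF.
  - by move=> x; rewrite lee_fin expR_ge0.
have iw : P.-integrable setT (EFin \o w).
  apply/integrableP; split; first exact/measurable_EFinP.
  under eq_integral do rewrite /= ger0_norm ?expR_ge0//.
  exact: le_lt_trans Pw Qphi.
have iphi : P.-integrable setT (EFin \o phi).
  by apply: measurable_bounded_integrable => //; rewrite ltey_eq fin_num_measure.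
have i1 : P.-integrable setT (EFin \o cst 1%R).
  exact: finite_measure_integrable_cst.
have iphi1 : P.-integrable setT (EFin \o (phi \+ cst 1%R)%R).
  rewrite (_ : _ \o _ = (EFin \o phi) \+ (EFin \o cst 1%R)); last exact/funext.
  exact: integrableD.
apply: (@le_trans _ _ (\int[P]_x ((phi x + 1)%:E - (w x)%:E))).
  rewrite (integralB_EFin _ iphi1 iw)//.
  rewrite (integralD_EFin measurableT iphi i1)/= integral_cst// mul1e.
  by apply: leeB => //; apply: leeD => //; rewrite -(probability_setT P).
apply: le_integralT.
- by apply: emeasurable_funB; apply/measurable_EFinP => //; exact: measurable_funD.
- exact/measurable_EFinP.
- by move=> x; rewrite -EFinB lee_fin /w; have := expR_ge1Dx (phi x - ln (f x))%R; lra.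
Qed.
End KL_lower_bound.

(** * Densities and couplings *)

Section densities.
Local Open Scope ereal_scope.

Lemma finite_measure_of_le d (T : measurableType d) (R : realType)
    (mu : {finite_measure set T -> \bar R}) (nu : {measure set T -> \bar R}) :
  (forall A, measurable A -> nu A <= mu A) ->
  exists nu' : {finite_measure set T -> \bar R}, forall A, nu' A = nu A.
Proof.
move=> numu; have finnu : fin_num_fun nu.
  move=> A mA; rewrite ge0_fin_numE// (le_lt_trans (numu A mA))//.
  by rewrite ltey_eq fin_num_measure.
have sigfin : sigma_finite setT nu.
  by apply: fin_num_fun_sigma_finite => //; rewrite measure0.
pose H1 := @isFinite.Build d T R nu finnu.
pose H2 := @isSFinite.Build d T R nu (sfinite_measure_sigma_finite sigfin).
pose H3 := @isSigmaFinite.Build d T R nu sigfin.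
pose nu' := HB.pack_for (FiniteMeasure.type T R) (Measure.sort nu) H1 H2 H3.
by exists nu'.
Qed.

Lemma induced_measure d (T : measurableType d) (R : realType)
    (mu : {measure set T -> \bar R}) (f : T -> \bar R) :
  measurable_fun setT f -> (forall x, 0 <= f x) ->
  exists nu : {measure set T -> \bar R}, forall A, nu A = \int[mu]_(x in A) f x.
Proof.
move=> mf f0; pose nu A := \int[mu]_(x in A) f x.
have nu0 : nu set0 = 0 by rewrite /nu integral_set0.
have nu_ge0 A : 0 <= nu A by exact: integral_ge0.
have nu_sa : semi_sigma_additive nu := semi_sigma_additive_nng_induced mf f0.
pose H := @isMeasure.Build d T R nu nu0 nu_ge0 nu_sa.
pose nu' := HB.pack_for (Measure.type T R) nu H.
by exists nu'.
Qed.

(** The Radon-Nikodym density [g] is bounded by 1 only almost everywhere, so it is truncated. This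
    changes no integral: on [A] minus [B], where [g] exceeds 1, [nu] and [mu] bound each other and
    are equal. *)
Lemma density_le1 d (T : measurableType d) (R : realType)
    (mu : {finite_measure set T -> \bar R}) (nu : {measure set T -> \bar R}) :
  (forall A, measurable A -> nu A <= mu A) ->
  exists q : T -> R, [/\ measurable_fun setT q,
    forall x, (0 <= q x <= 1)%R &
    forall A, measurable A -> nu A = \int[mu]_(x in A) (q x)%:E].
Proof.
move=> numu; have [nu' nuE] := finite_measure_of_le numu.
have dom : nu' `<< mu.
  apply/null_content_dominatesP => A mA muA0; apply/eqP.
  by rewrite eq_le measure_ge0 andbT nuE -muA0 numu.
have [f [f0 ffin fint fE]] := radon_nikodym_sigma_finite dom.
have mf : measurable_fun setT f by exact: measurable_int fint.
have nufE A : measurable A -> nu A = \int[mu]_(x in A) f x.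
  by move=> mA; rewrite -nuE fE.
pose g x := fine (f x); have fg x : f x = (g x)%:E by rewrite fineK.
have mg : measurable_fun setT g by exact: measurableT_comp.
have g0 x : (0 <= g x)%R by rewrite -lee_fin -fg.
pose q x := Num.min (g x) 1%R.
have mq : measurable_fun setT q by exact: measurable_minr.
have q0 x : (0 <= q x)%R by rewrite le_min g0 ler01.
exists q; split => // [x|A mA]; first by rewrite q0 ge_min lexx orbT.
pose B : set T := [set x | (g x <= 1)%R].
have mB : measurable B by exact: measurable_set_ler.
rewrite -(setUIDK A B).
have mAB : measurable (A `&` B) by exact: measurableI.
have mADB : measurable (A `\` B) by exact: measurableD.
have dAB : [disjoint A `&` B & A `\` B].
  by apply/disj_set2P; rewrite setDE setIACA setICr setI0.
rewrite measureU//; last by apply/disj_set2P.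
rewrite ge0_integral_setU//; last 2 first.
- by apply: measurable_funTS; exact/measurable_EFinP.
- by move=> x _; rewrite lee_fin.
congr (_ + _).
  rewrite [LHS]nufE//; apply: eq_integral => x /[!inE] -[_ Bx].
  by rewrite fg /q min_l.
have -> : \int[mu]_(x in A `\` B) (q x)%:E = mu (A `\` B).
  rewrite -[RHS]mul1e -integral_cst//; apply: eq_integral => x /[!inE] -[_ Bx].
  by rewrite /q min_r// ltW// ltNge; apply/negP.
apply/eqP; rewrite eq_le [X in X && _]numu//= [leRHS]nufE//.
rewrite -[leLHS]mul1e -integral_cst//; apply: ge0_le_integral => //.
- exact: measurable_funTS.
- by move=> x [_ Bx]; rewrite fg lee_fin ltW// ltNge; apply/negP.
Qed.

(* The density is the conditional expectation, given the first coordinate, of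
   the density of [nu] at the second one. *)
Lemma coupling_density d1 d2 (T1 : measurableType d1) (T2 : measurableType d2)
    (R : realType) (gamma : probability (T1 * T2)%type R)
    (mu1 : probability T1 R) (mu2 : probability T2 R)
    (nu : {measure set T2 -> \bar R}) :
  (forall A, measurable A -> distribution gamma mfst A = mu1 A) ->
  (forall A, measurable A -> distribution gamma msnd A = mu2 A) ->
  (forall A, measurable A -> nu A <= mu2 A) ->
  exists p : T1 -> R, [/\ measurable_fun setT p,
    forall x, (0 <= p x <= 1)%R,
    \int[mu1]_x (p x)%:E = nu setT &
    forall A C, measurable A -> measurable C -> gamma (~` A `*` C) = 0 ->
      nu C <= \int[mu1]_(x in A) (p x)%:E].
Proof.
move=> H1 H2 numu; have [q [mq q01 nuE]] := density_le1 numu.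
pose q' (w : T1 * T2) := (q w.2)%:E.
have mq' : measurable_fun setT q' by apply/measurable_EFinP; exact: measurableT_comp.
have q'0 w : 0 <= q' w by rewrite lee_fin; case/andP: (q01 w.2).
have q'1 w : q' w <= 1 by rewrite lee_fin; case/andP: (q01 w.2).
have q'le1 A : measurable A -> \int[gamma]_(w in A) q' w <= gamma A.
  move=> mA; rewrite -[leRHS]mul1e -integral_cst//; apply: ge0_le_integral => //.
  exact: measurable_funTS.
(* [lam] is the coupling weighted by the density at the second coordinate: its second marginal is
   [nu], and its first marginal [lam1], dominated by [mu1], has the required density [p]. *)
have [lam lamE] := induced_measure gamma mq' q'0.
have mpre A : measurable A -> measurable ((@mfst _ _ T1 T2) @^-1` A).
  by move=> mA; rewrite -[X in measurable X]setTI; exact: measurable_fst.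
have mpre2 A : measurable A -> measurable ((@msnd _ _ T1 T2) @^-1` A).
  by move=> mA; rewrite -[X in measurable X]setTI; exact: measurable_snd.
have [lam1 lam1E] : exists m : {measure set T1 -> \bar R},
    forall A, m A = lam (mfst @^-1` A).
  have mfst_mf := @measurable_fst _ _ T1 T2.
  by exists (measure_function_pushforward__canonical__measure_function_Measure lam mfst_mf).
have nuC C : measurable C -> nu C = lam (msnd @^-1` C).
  move=> mC; rewrite nuE// lamE.
  rewrite (eq_measure_integral (distribution gamma msnd))//; last first.
    by move=> A mA _; symmetry; exact: H2.
  rewrite ge0_integral_pushforward//.
  - by apply: measurable_funTS; exact/measurable_EFinP.
  - by move=> y _; rewrite lee_fin; case/andP: (q01 y).
have [|p [mp p01 pE]] := @density_le1 _ _ _ mu1 lam1.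
  by move=> A mA; rewrite lam1E lamE -[leRHS](H1 A mA); apply: q'le1; exact: mpre.
exists p; split => //.
- by rewrite -pE// lam1E nuC// !preimage_setT.
- move=> A C mA mC AC0; rewrite -pE// lam1E nuC//.
  have mAC : measurable (~` A `*` C) by apply: measurableX => //; exact: measurableC.
  have lam0 : lam (~` A `*` C) = 0.
    by apply/eqP; rewrite eq_le measure_ge0 andbT lamE -AC0 q'le1.
  apply: (@le_trans _ _ (lam ((mfst @^-1` A) `|` (~` A `*` C)))).
    apply: le_measure; rewrite ?inE; [exact: mpre2| |].
      by apply: measurableU => //; exact: mpre.
    by move=> [x y] /= Cy; have [Ax|Ax] := pselect (A x); [left|right].
  rewrite (@le_trans _ _ (lam (mfst @^-1` A) + lam (~` A `*` C)))//.
    by apply: measureU2 => //; exact: mpre.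
  by rewrite lam0 adde0.
Qed.
End densities.

(** * Fano's inequality *)

Section fano.
Local Open Scope ereal_scope.

(** Convexity of the exponential: the tangent at [u = c * t] lies below the graph at 0 and at [c],
    and these two inequalities are averaged with weights [1 - t] and [t]. *)
Lemma expR_chord (R : realType) (c t : R) : (0 <= t <= 1)%R ->
  (expR (c * t) <= 1 + (expR c - 1) * t)%R.
Proof.
move=> /andP[t0 t1]; set u := (c * t)%R.
have e0 : (expR u * (1 - u) <= 1)%R.
  have := ler_wpM2l (expR_ge0 u) (expR_ge1Dx (- u)%R).
  by rewrite -expRD subrr expR0.
have e1 : (expR u * (1 + (c - u)) <= expR c)%R.
  have := ler_wpM2l (expR_ge0 u) (expR_ge1Dx (c - u)%R).
  by rewrite -expRD [(u + _)%R]addrC subrK.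
have t0' : (0 <= 1 - t)%R by rewrite subr_ge0.
have := lerD (ler_wpM2l t0' e0) (ler_wpM2l t0 e1).
have -> : ((1 - t) * (expR u * (1 - u)) + t * (expR u * (1 + (c - u))) = expR u)%R.
  by rewrite /u; ring.
by move=> /le_trans; apply; rewrite le_eqVlt; apply/orP; left; apply/eqP; ring.
Qed.

Context d1 d2 (T1 : measurableType d1) (T2 : measurableType d2) (R : realType).
Variables (mu : probability T1 R) (g : {mfun T1 >-> T2}).

(** The variational bound with test function 0. *)
Lemma feature_information_ge0 : 0 <= feature_information mu g.
Proof.
have b0 : [bounded (cst 0%R : T1 * T2 -> R) x | x in [set: T1 * T2]].
  by exists 0%R; split => // N N0 x _ /=; rewrite normr0 ltW.
set Q := distribution mu mid \x distribution mu g.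
have Q1 : \int[Q]_x (expR (cst 0%R x))%:E <= 1.
  under eq_integral do rewrite /= expR0.
  by rewrite integral_cst// mul1e probability_le1.
apply: (le_trans _ (KL_divergence_ge (distribution mu (mpair mid g))
  (measurable_cst _) b0 (le_lt_trans Q1 (ltry _)))).
by rewrite integral0 add0e sube_ge0// orbT.
Qed.

(* Donsker-Varadhan with the test function [ln M * S - ln 2], where [S] is the
   posterior probability that the label guessed from the feature is correct;
   [S] has mean at most [M^-1] under the product of the marginals. *)
Lemma feature_information_fano (Y : finType) (p : Y -> T1 -> R)
    (J : Y -> set T2) (s : R) :
  (0 < #|Y|)%N ->
  (forall y, measurable_fun setT (p y)) -> (forall y x, (0 <= p y x <= 1)%R) ->
  (forall y, \int[mu]_x (p y x)%:E = (#|Y|%:R^-1)%:E) ->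
  (forall y, measurable (J y)) ->
  (forall y y' z, J y z -> J y' z -> y = y') ->
  s%:E <= \sum_(y : Y) \int[mu]_(x in g @^-1` J y) (p y x)%:E ->
  (s * ln #|Y|%:R - ln 2)%:E <= feature_information mu g.
Proof.
move=> Y0 mp p01 pM mJ tJ sle.
set M : R := #|Y|%:R; have M1 : (1 <= M)%R by rewrite ler1n.
have M0 : (0 < M)%R by exact: lt_le_trans M1.
pose S (w : T1 * T2) : R := (\sum_(y : Y) p y w.1 * \1_(J y) w.2)%R.
have SJ y x z : J y z -> S (x, z) = p y x.
  move=> Jz; rewrite /S (bigD1 y)//= big1 ?addr0.
    by rewrite indicE mem_set// mulr1.
  move=> y' yy'; rewrite indicE memNset ?mulr0// => Jz'.
  by move: yy'; rewrite (tJ _ _ _ Jz Jz') eqxx.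
have S0 x z : (forall y, ~ J y z) -> S (x, z) = 0%R.
  by move=> Jz; rewrite /S big1// => y _; rewrite indicE memNset ?mulr0//; exact: Jz.
have S01 w : (0 <= S w <= 1)%R.
  case: w => x z; have [[y Jz]|Jz] := pselect (exists y, J y z).
    by rewrite (SJ y).
  by rewrite S0 ?lexx ?ler01// => y Jyz; apply: Jz; exists y.
have mS : measurable_fun setT S.
  apply: measurable_sum => y; apply: measurable_funM.
    by apply: measurableT_comp => //; exact: measurable_fst.
  by apply: measurableT_comp; [exact: measurable_indic|exact: measurable_snd].
set c := ln M; have c0 : (0 <= c)%R by exact: ln_ge0.
pose phi w : R := (c * S w - ln 2)%R.
have mphi : measurable_fun setT phi.
  by apply: measurable_funB => //; exact: measurable_funM.
have bphi : [bounded phi x | x in [set: T1 * T2]].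
  exists (c + ln 2)%R; split=> [|N cN w _]; first exact: num_real.
  apply: ltW; apply: le_lt_trans cN.
  have /andP[Sw0 Sw1] := S01 w.
  have ln20 : (0 <= ln 2 :> R)%R by rewrite ln_ge0// ler1n.
  have : (0 <= c * S w)%R by exact: mulr_ge0.
  have : (c * S w <= c)%R by rewrite ler_piMr.
  by move=> ? ?; rewrite /phi ler_norml; apply/andP; split; lra.
set Q := distribution mu mid \x distribution mu g.
(* Under the product law the input is independent of the feature: with [z] fixed, [S] is a single
   [p y], of mean [M^-1], or 0. *)
have QS : \int[Q]_w (S w)%:E <= M^-1%:E.
  rewrite fubini_tonelli2//; last 2 first.
  - exact/measurable_EFinP.
  - by move=> w; rewrite lee_fin; case/andP: (S01 w).
  apply: (@le_trans _ _ (\int[distribution mu g]_z (cst M^-1%:E) z)); last first.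
    rewrite integral_cst// -[leRHS]mule1 lee_wpmul2l ?probability_le1//.
    by rewrite lee_fin invr_ge0 ltW.
  apply: ge0_le_integral => //.
  - by move=> z _; apply: integral_ge0 => x _; rewrite lee_fin; case/andP: (S01 (x, z)).
  - apply: measurable_fun_fubini_tonelli_G; first exact/measurable_EFinP.
    by move=> w; rewrite lee_fin; case/andP: (S01 w).
  - move=> z _; rewrite /fubini_G/= ge0_integral_distribution//; last 2 first.
    + apply/measurable_EFinP; exact: (measurableT_comp mS (measurable_pair2 _)).
    + by move=> x; rewrite lee_fin; case/andP: (S01 (x, z)).
    have [[y Jz]|Jz] := pselect (exists y, J y z).
      rewrite -(pM y) le_eqVlt; apply/orP; left; apply/eqP.
      by apply: eq_integral => x _; rewrite /= (SJ y).
    rewrite integral0_eq ?lee_fin ?invr_ge0 ?(ltW M0)// => x _ /=.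
    by rewrite S0// => y Jyz; apply: Jz; exists y.
(* By the chord bound, [expR (c * S)] is at most [1 + (M - 1) * S], whose mean is at most
   [1 + (M - 1) / M], below 2; the shift by [ln 2] in [phi] divides by 2. *)
have Qphi : \int[Q]_w (expR (phi w))%:E <= 1.
  pose k : R := ((M - 1) / 2)%R; have k0 : (0 <= k)%R by rewrite divr_ge0// subr_ge0.
  apply: (@le_trans _ _ (\int[Q]_w ((2^-1)%:E + k%:E * (S w)%:E))).
    apply: ge0_le_integral => //.
    - by apply/measurable_EFinP; apply: measurableT_comp => //; exact: measurable_expR.
    - by apply/measurable_EFinP; apply: measurable_funD => //; exact: measurable_funM.
    - move=> w _; have ln2 : expR (ln 2%R) = 2%R :> R by rewrite lnK ?posrE.
      rewrite -EFinM -EFinD lee_fin expRB ln2.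
      have := expR_chord c (S01 w); rewrite lnK ?posrE// /k => h.
      by rewrite ler_pdivrMr//; apply: (le_trans h); lra.
  rewrite ge0_integralD//; last 2 first.
  - by move=> w _; rewrite mule_ge0// lee_fin//; case/andP: (S01 w).
  - by apply/measurable_EFinP; exact: measurable_funM.
  rewrite ge0_integralZl//; last 2 first.
  - exact/measurable_EFinP.
  - by move=> w _; rewrite lee_fin; case/andP: (S01 w).
  apply: (@le_trans _ _ ((2^-1)%:E * 1 + k%:E * M^-1%:E)).
    apply: leeD; last by rewrite lee_wpmul2l// lee_fin.
    by rewrite integral_cst// lee_wpmul2l// ?lee_fin ?invr_ge0// probability_le1.
  rewrite mule1 -EFinM -EFinD lee_fin /k.
  have : (M^-1 * M = 1)%R by rewrite mulVf// gt_eqF.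
  have : (0 <= M^-1)%R by rewrite invr_ge0 ltW.
  nra.
pose P := distribution mu (mpair mid g).
have PS : s%:E <= \int[P]_w (S w)%:E.
  rewrite ge0_integral_distribution//; last 2 first.
  - exact/measurable_EFinP.
  - by move=> w; rewrite lee_fin; case/andP: (S01 w).
  apply: (le_trans sle).
  have -> : \int[mu]_x ((fun w => (S w)%:E) \o mpair mid g) x =
      \int[mu]_x \sum_(y : Y) (p y x * \1_(J y) (g x))%:E.
    by apply: eq_integral => x _; rewrite sumEFin.
  rewrite ge0_integral_sum//; last 2 first.
  - move=> y; apply/measurable_EFinP; apply: measurable_funM => //.
    by apply: measurableT_comp => //; exact: measurable_indic.
  - by move=> y x _; rewrite lee_fin mulr_ge0//; case/andP: (p01 y x).
  apply: lee_sum => y _; rewrite [leLHS]integral_mkcond le_eqVlt; apply/orP; left; apply/eqP.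
  by apply: eq_integral => x _; rewrite epatch_indic/= EFinM.
have iS : P.-integrable setT (EFin \o (fun w => c * S w)%R).
  apply: measurable_bounded_integrable => //.
  - by rewrite ltey_eq fin_num_measure.
  - exact: measurable_funM.
  - exists c; split=> [|N cN w _]; first exact: num_real.
    apply: ltW; apply: le_lt_trans cN.
    have /andP[Sw0 Sw1] := S01 w.
    by rewrite ger0_norm ?mulr_ge0// ler_piMr.
have i2 : P.-integrable setT (EFin \o cst (ln 2 : R)).
  exact: finite_measure_integrable_cst.
have Pphi : (s * c - ln 2)%:E <= \int[P]_w (phi w)%:E.
  have -> : \int[P]_w (phi w)%:E = \int[P]_w ((c * S w)%:E - (cst (ln 2) w)%:E) by [].
  rewrite (integralB_EFin measurableT iS i2)/=.
  under eq_integral do rewrite EFinM.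
  rewrite ge0_integralZl//; last 2 first.
  - exact/measurable_EFinP.
  - by move=> w _; rewrite lee_fin; case/andP: (S01 w).
  rewrite EFinB; apply: leeB.
    by rewrite mulrC EFinM lee_wpmul2l.
  rewrite (integral_cst _ _ (ln 2)%:E)// -[leRHS]mule1 lee_wpmul2l ?probability_le1//.
  by rewrite lee_fin ln_ge0// ler1n.
apply: (le_trans _ (KL_divergence_ge P mphi bphi (le_lt_trans Qphi (ltry _)))).
by rewrite -[leLHS]adde0 -addeA; apply: leeD => //; rewrite sube_ge0// orbT.
Qed.
End fano.

(** * Robust features *)

Section preliminaries.
Local Open Scope ereal_scope.

(** Replaces the adversarial event, which may fail to be measurable, by a measurable superset of
    nearly the same mass. *)
Lemma mu_ext_lt_cover d (T : sigmaRingType d) (R : realType)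
    (mu : {measure set T -> \bar R}) (A : set T) (r : \bar R) :
  mu_ext mu A < r -> exists E, [/\ measurable E, A `<=` E & mu E < r].
Proof.
move=> /ereal_inf_lt[_ [F [mF AF] <-] Fr]; exists (\bigcup_k F k).
have mU : measurable (\bigcup_k F k) by exact: bigcupT_measurable.
by split => //; apply: le_lt_trans Fr; exact: measure_sigma_subadditive.
Qed.

Lemma measure_le_sum_cover d (T : ringOfSetsType d) (R : realFieldType)
    (mu : {measure set T -> \bar R}) (I : finType) (A : set T)
    (F : I -> set T) : measurable A -> (forall i, measurable (F i)) ->
  (forall x, A x -> exists i, F i x) -> mu A <= \sum_(i : I) mu (F i).
Proof.
move=> mA mF AF.
have [mU leU] : measurable (\big[setU/set0]_(i : I) F i) /\
    mu (\big[setU/set0]_(i : I) F i) <= \sum_(i : I) mu (F i).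
  elim/big_rec2: _ => [|i B s _ [mB Bs]]; first by rewrite measure0.
  split; first exact: measurableU.
  by apply: le_trans (measureU2 _ _ _) _ => //; exact: leeD.
apply: le_trans leU; apply: le_measure; rewrite ?inE// => x /AF[i Fx].
by rewrite (bigD1 i)//=; left.
Qed.

(** The unnormalised law of the inputs labelled [y], obtained by restriction and pushforward; it is
    finite because the input marginal dominates it. *)
Lemma slice_measure d (T : measurableType d) (Y : pfinType) (R : realType)
    (mu : probability (T * label_space Y)%type R) (y : Y) :
  exists nu : {finite_measure set T -> \bar R},
    forall A, nu A = mu (A `*` [set y]).
Proof.
have mY : measurable ([set: T] `*` [set y] : set (T * label_space Y)).
  exact: measurableX.
have mf := @measurable_fst _ _ T (label_space Y).
pose nu := measure_function_pushforward__canonical__measure_function_Measure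
  (mrestr mu mY) mf.
have nuE A : nu A = mu (A `*` [set y]).
  rewrite /nu/= /pushforward/= /mrestr; congr (mu _).
  by apply/seteqP; split => -[a b]/= [] // ? [].
have [|nu' nu'E] := @finite_measure_of_le _ _ _ (distribution mu mfst) nu.
  move=> A mA; rewrite nuE; apply: le_measure; rewrite ?inE//.
  - exact: measurableX.
  - by rewrite -[X in measurable X]setTI; exact: measurable_fst.
  - by move=> [a b]/= [].
by exists nu' => A; rewrite nu'E.
Qed.

(** The strict inequality allows a choice below both infima, so neither has to be attained. *)
Lemma W_infty_lt_coupling (R : realType) d (X : set 'rV[R]_d)
    (Delta : 'rV[R]_d -> 'rV[R]_d -> R) (mu nu : probability (borel_rV R d) R)
    (t : R) :
  measurable (X : set (borel_rV R d)) -> lsc_metric X Delta ->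
  W_infty X Delta mu nu < t%:E ->
  exists2 gamma, coupling mu nu gamma &
    gamma [set p | [/\ X p.1, X p.2 & (t < Delta p.1 p.2)%R]] = 0.
Proof.
move=> mX lscD /ereal_inf_lt[_ [gamma cgamma <-]].
move=> /ereal_inf_lt[_ [s [s0 gs0] <-]]; rewrite lte_fin => st.
exists gamma => //; apply/eqP; rewrite eq_le measure_ge0 andbT -gs0.
apply: le_measure; rewrite ?inE; [exact: measurable_lsc_sublevel_compl..|].
by move=> p [X1 X2 tD]; split => //; exact: lt_trans tD.
Qed.

End preliminaries.

Section robust_fano.
Local Open Scope ereal_scope.
Context {R : realType} {d n : nat}.
Variables (X : set 'rV[R]_d) (Delta : 'rV[R]_d -> 'rV[R]_d -> R).
Hypotheses (mX : measurable (X : set (borel_rV R d))) (lscD : lsc_metric X Delta).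
Variables (Y : pfinType)
  (muXY : probability (borel_rV R d * label_space Y)%type R).
Hypothesis muXY_X : muXY (X `*` [set: Y]) = 1.
Variables (eps : R) (g : {mfun borel_rV R d >-> borel_rV R n}).
Variable h : 'rV[R]_n -> Y.

(* The compact sets [C y] gather inputs of label [y] around which [h \o g] is
   constantly [y]; [J y] consists of features of inputs within [eps] of [C y]. *)
Lemma robust_label_cells (mu' : probability (borel_rV R d) R) (r e : R) :
  adv_risk X Delta muXY eps (h \o g) < r%:E -> (0 < e)%R ->
  exists (C : Y -> set 'rV[R]_d) (J : Y -> set 'rV[R]_n), [/\
    forall y, compact (C y) /\ C y `<=` X,
    forall y, measurable (J y : set (borel_rV R n)) /\
      mu' (thickening X (C y) Delta eps `\` g @^-1` J y) < e%:E,
    forall y y' z, J y z -> J y' z -> y = y' &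
    (1 - r - #|Y|%:R * e)%:E <= \sum_(y : Y) muXY (C y `*` [set y])].
Proof.
move=> /mu_ext_lt_cover[E [mE advE Er]] e0.
(* Inputs that, with label [y], avoid the cover [E] of the adversarial event: [h \o g] equals [y] on
   the whole [eps]-ball around them. *)
pose B (y : Y) : set (borel_rV R d) := X `\` ysection E y.
have mB y : measurable (B y) by apply: measurableD => //; exact: measurable_ysection.
have hB y x x' : B y x -> X x' -> (Delta x' x <= eps)%R -> h (g x') = y.
  move=> [Xx Ex] Xx' xx'; apply: contrapT => hx'; apply: Ex.
  by rewrite /ysection/= inE; apply: advE; exists x'.
have /choice[C HC] y : exists C : set 'rV[R]_d, [/\ compact C, C `<=` B y &
    muXY (B y `*` [set y]) <= muXY (C `*` [set y]) + e%:E].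
  have [nu nuE] := slice_measure muXY y.
  have [C [cC CB Ce]] := compact_inner nu (mB y) e0.
  exists C; split => //; rewrite -!nuE.
  have mC : measurable (C : set (borel_rV R d)).
    by apply: closed_measurable_rV; exact: compact_closed.
  rewrite -[in leLHS](setDUK CB); apply: (le_trans (measureU2 _ _ _)) => //.
    exact: measurableD.
  by apply: leeD => //; exact: ltW.
have CX y : C y `<=` X by have [_ CB _] := HC y; move=> x /CB[].
have cC y : compact (C y) by have [] := HC y.
have mT y : measurable (thickening X (C y) Delta eps : set (borel_rV R d)).
  exact: measurable_thickening.
have mg : measurable_fun setT (g : borel_rV R d -> borel_rV R n).
  exact: measurable_funPT.
have /choice[K HK] y := compact_image_inner mu' mg (mT y) e0.
have mgK y : measurable (g @` (K y) : set (borel_rV R n)).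
  by have [_ _ cgK _] := HK y; apply: closed_measurable_rV; exact: compact_closed.
(* Each cell lies in a fiber of [h], hence disjointness, and is compact, hence measurable whatever
   [h] is. *)
have hJ y z : (g @` (K y)) z -> h z = y.
  move=> [x Kx <-]; have [_ KT _ _] := HK y; have [Xx [x0 Cx0 xx0]] := KT _ Kx.
  by have [_ CB _] := HC y; exact: hB (CB _ Cx0) _ _.
exists C, (fun y => g @` (K y)); split => //.
- move=> y; split => //; have [cK KT _ Ke] := HK y; apply: le_lt_trans Ke.
  have mK : measurable (K y : set (borel_rV R d)).
    by apply: closed_measurable_rV; exact: compact_closed.
  apply: le_measure; rewrite ?inE; [|exact: measurableD|].
    by apply: measurableD => //; rewrite -[X in measurable X]setTI; exact: mg.
  by move=> x [Tx gKx]; split => // Kx; apply: gKx; exists x.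
- by move=> y y' z /hJ <- /hJ.
have mXY : measurable (X `*` [set: Y] : set (borel_rV R d * label_space Y)).
  exact: measurableX.
have : (1 - r)%:E <= \sum_(y : Y) muXY (B y `*` [set y]).
  apply: (@le_trans _ _ (muXY ((X `*` [set: Y]) `\` E))).
    rewrite measureD//; last by rewrite ltey_eq fin_num_measure.
    rewrite [X in X - _]muXY_X EFinB leeB//; apply: ltW; apply: le_lt_trans Er.
    by apply: le_measure; rewrite ?inE//; exact: measurableI.
  apply: measure_le_sum_cover; first exact: measurableD.
    by move=> y; exact: measurableX.
  move=> [x y] /= [[Xx _] Exy]; exists y; split => //; split => //.
  by rewrite /ysection/= inE.
move=> le1; have : (1 - r)%:E <= \sum_(y : Y) (muXY (C y `*` [set y]) + e%:E).
  by apply: le_trans le1 _; apply: lee_sum => y _; have [] := HC y.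
rewrite big_split/= sumEFin sumr_const => le2.
by rewrite EFinB leeBlDr// mulr_natl.
Qed.

Lemma robust_fano (mu' : probability (borel_rV R d) R) (r : R) :
  (forall y : Y, distribution muXY msnd [set y] = (#|Y|%:R^-1)%:E) ->
  adv_risk X Delta muXY eps (h \o g) < r%:E ->
  W_infty_ball X Delta (distribution muXY mfst) eps mu' ->
  ((1 - r) * ln #|Y|%:R - ln 2)%:E <= feature_information mu' g.
Proof.
move=> muY advr [mu'X Wmu'].
have Y0 : (0 < #|Y|)%N by apply/card_gt0P; exists point.
have M0 : (0 < #|Y|%:R :> R)%R by rewrite ltr0n.
(* The gap between [s] and [1 - r] pays for the approximations; [s] then tends to [1 - r]. The added
   1 in the denominator below covers the case [ln #|Y| = 0]. *)
suff Hs s : (s < 1 - r)%R ->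
    (s * ln #|Y|%:R - ln 2)%:E <= feature_information mu' g.
  have L0 : (0 <= ln #|Y|%:R :> R)%R by rewrite ln_ge0// ler1n.
  have L1 : (0 < ln #|Y|%:R + 1 :> R)%R by rewrite ltr_wpDl.
  apply/lee_subgt0Pr => e e0; pose s := (1 - r - e / (ln #|Y|%:R + 1))%R.
  apply: le_trans (Hs s _); last by rewrite ltrBlDr ltrDl divr_gt0.
  have : (e / (ln #|Y|%:R + 1) * ln #|Y|%:R <= e)%R.
    by rewrite mulrAC ler_pdivrMr// ler_pM2l// lerDl.
  by rewrite -EFinB lee_fin /s; lra.
(* An error [e] per label is spent twice, on the compact sets [C y] and on the part of the
   thickenings missed by [J y], so that [2 * #|Y| * e] is the gap. *)
move=> sr; pose e := ((1 - r - s) / (2 * #|Y|%:R))%R.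
have e0 : (0 < e)%R by rewrite divr_gt0 ?mulr_gt0// subr_gt0.
have [C [J [CP JP JJ Cr]]] := robust_label_cells mu' advr e0.
have mJ y : measurable (J y : set (borel_rV R n)) by have [] := JP y.
have mgJ y : measurable (g @^-1` J y : set (borel_rV R d)).
  rewrite -[X in measurable X]setTI.
  have mg : measurable_fun setT (g : borel_rV R d -> borel_rV R n).
    exact: measurable_funPT.
  exact: mg.
have cC y : compact (C y) by have [] := CP y.
have CX y : C y `<=` X by have [] := CP y.
pose T y k := thickening X (C y) Delta (eps + k.+1%:R^-1).
have mT y k : measurable (T y k : set (borel_rV R d)) by exact: measurable_thickening.
have mC y : measurable (C y : set (borel_rV R d)).
  by apply: closed_measurable_rV; exact: compact_closed.
(* The labels are finitely many, so a single enlargement [1/(k+1)] of the radius suits all of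
   them. *)
have [k _ /(_ k (leqnn k)) Tk] : \forall k \near \oo, forall y,
    mu' (T y k `\` g @^-1` J y) < e%:E.
  apply: filter_forall => y; apply: near_measure_bigcap_lt.
  - by move=> k; exact: measurableD.
  - move=> a b ab x [[Xx [x0 Cx0 xx0]] Jx]; split => //; split => //; exists x0 => //.
    by apply: le_trans xx0 _; rewrite lerD2l lef_pV2 ?posrE// ler_nat.
  - have [_] := JP y; apply: le_lt_trans; apply: le_measure; rewrite ?inE.
    + by apply: bigcapT_measurable => k; exact: measurableD.
    + by apply: measurableD => //; exact: measurable_thickening.
    + move=> x Tx; split; last by have [] := Tx 0%N I.
      by apply: bigcap_thickening => // k _; have [] := Tx k I.
have [|gamma [gamma1 gamma2] gamma0] := @W_infty_lt_coupling _ _ X Delta mu'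
    (distribution muXY mfst) (eps + k.+1%:R^-1) mX lscD.
  by apply: le_lt_trans Wmu' _; rewrite lte_fin ltrDl invr_gt0.
have /choice[p Hp] y : exists p : borel_rV R d -> R, [/\ measurable_fun setT p,
    forall x, (0 <= p x <= 1)%R, \int[mu']_x (p x)%:E = (#|Y|%:R^-1)%:E &
    muXY (C y `*` [set y]) <= \int[mu']_(x in T y k) (p x)%:E].
  have [nu nuE] := slice_measure muXY y.
  have [|p [mp p01 pT pC]] := @coupling_density _ _ _ _ R gamma mu'
      (distribution muXY mfst) nu gamma1 gamma2.
    move=> A mA; have := nuE A; rewrite /= => ->; apply: le_measure; rewrite ?inE.
    - exact: measurableX.
    - by rewrite -[X in measurable X]setTI; exact: measurable_fst.
    - by move=> [a b]/= [].
  exists p; split => //.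
    rewrite pT [LHS](nuE setT) -(muY y); congr (muXY _).
    by apply/seteqP; split => -[a b]/=; rewrite /msnd/= => // -[].
  apply: (@le_trans _ _ (nu (C y))); first by rewrite [leRHS](nuE (C y)).
  apply: pC => //; apply/eqP; rewrite eq_le measure_ge0 andbT.
  (* A pair whose second point is in [C y] and whose first is outside [T y k] either starts outside
     [X], which [mu'] does not charge, or is moved farther than [gamma] allows. *)
  pose D : set (borel_rV R d * borel_rV R d) :=
    [set p | [/\ X p.1, X p.2 & (eps + k.+1%:R^-1 < Delta p.1 p.2)%R]].
  have mD : measurable D by exact: measurable_lsc_sublevel_compl.
  pose N : set (borel_rV R d * borel_rV R d) := [set p | ~ X p.1].
  have mN : measurable N.
    rewrite -[N]setTI.
    apply: (@measurable_fst _ _ (borel_rV R d) (borel_rV R d) measurableT (~` X)).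
    exact: measurableC.
  apply: (@le_trans _ _ (gamma (N `|` D))).
    apply: le_measure; rewrite ?inE.
    - by apply: measurableX => //; exact: measurableC.
    - exact: measurableU.
    - move=> [a b] /= [Ta Cb]; have [Xa|Xa] := pselect (X a); last by left.
      right; split => //=; first exact: CX Cb.
      by rewrite ltNge; apply/negP => ab; apply: Ta; split => //; exists b.
  apply: (le_trans (measureU2 _ mN mD)); rewrite [X in _ + X]gamma0 adde0.
  rewrite [leLHS](gamma1 (~` X) (measurableC mX)).
  by rewrite probability_setC// [X in _ - X]mu'X subee.
have pJ y : muXY (C y `*` [set y]) <=
    \int[mu']_(x in g @^-1` J y) (p y x)%:E + e%:E.
  have [mp p01 _ pC] := Hp y; apply: (le_trans pC).
  have mpE A : measurable_fun A (fun x => (p y x)%:E).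
    by apply: measurable_funTS; exact/measurable_EFinP.
  have p0 x : 0 <= (p y x)%:E by rewrite lee_fin; case/andP: (p01 x).
  pose G : set (borel_rV R d) := g @^-1` J y.
  pose D : set (borel_rV R d) := T y k `\` G.
  have mG : measurable G by exact: mgJ.
  have mD : measurable D by exact: measurableD.
  apply: (@le_trans _ _ (\int[mu']_(x in G `|` D) (p y x)%:E)).
    apply: ge0_subset_integral => //; first exact: measurableU.
    by move=> x Tx; have [Jx|Jx] := pselect (J y (g x)); [left|right].
  rewrite ge0_integral_setU//; last first.
    by apply/disj_set2P; rewrite /D setDE setICA setICr setI0.
  apply: leeD => //; apply: le_trans (ltW (Tk y)).
  rewrite -[leRHS]mul1e -integral_cst//; apply: ge0_le_integral => //.
  by move=> x _; rewrite lee_fin; case/andP: (p01 x).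
apply: (@feature_information_fano _ _ _ _ _ mu' g Y p J) => //;
  try by move=> y; have [] := Hp y.
have : (1 - r - #|Y|%:R * e)%:E <=
    \sum_(y : Y) (\int[mu']_(x in g @^-1` J y) (p y x)%:E + e%:E).
  by apply: le_trans Cr _; apply: lee_sum => y _.
rewrite big_split/= sumEFin sumr_const -leeBlDr// -EFinB; apply: le_trans.
have Me : (#|Y|%:R * e = (1 - r - s) / 2)%R by rewrite /e; field; rewrite gt_eqF.
by rewrite lee_fin -[(e *+ _)%R]mulr_natl Me; lra.
Qed.
End robust_fano.

(** * From bounds over the Wasserstein ball to the representation vulnerability *)

Lemma le_sub_rep_vulnerability (R : realType) (d : nat) (X : set 'rV[R]_d)
    (Delta : 'rV[R]_d -> 'rV[R]_d -> R) d' (T : measurableType d')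
    (mu : probability (borel_rV R d) R) (eps : R)
    (g : {mfun borel_rV R d >-> T}) (b : R) :
  (forall mu', W_infty_ball X Delta mu eps mu' ->
    (b%:E <= feature_information mu' g)%E) ->
  (b%:E <= (feature_information mu g - rep_vulnerability X Delta mu eps g)%dE)%E.
Proof.
(* Nonnegativity excludes the value [-oo]. If the information of [mu] is [+oo], the dual subtraction
   returns [+oo]; otherwise each member of the supremum is at most [i - b]. *)
move=> bI; have := feature_information_ge0 mu g.
case I0E : (feature_information mu g) => [i| |]// _; last first.
  by case: (rep_vulnerability _ _ _ _ _) => [r| |]; exact: leey.
have : (rep_vulnerability X Delta mu eps g <= (i - b)%:E)%E.
  apply: ge_ereal_sup => _ [mu' /bI bI' <-]; move: bI'.
  rewrite I0E; case: (feature_information mu' g) => [i'| |]//=.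
  - by rewrite !lee_fin => ?; rewrite lerD2l lerN2.
  - by move=> _; exact: leNye.
case: (rep_vulnerability _ _ _ _ _) => [r| |]//=.
  by rewrite !lee_fin; lra.
by move=> _; exact: leey.
Qed.

Theorem theorem3p4 (R : realType) (d n : nat)
  (X : set 'rV[R]_d) (mX : measurable (X : set (borel_rV R d)))
  (Delta : 'rV[R]_d -> 'rV[R]_d -> R)
  (Delta_metric : metric_on X Delta) (Delta_lsc : lsc_metric X Delta)
  (Z : set 'rV[R]_n) (Y : pfinType)
  (muXY : probability (borel_rV R d * label_space Y)%type R)
  (muXY_X : muXY (X `*` [set: Y]) = 1%E)
  (muY_unif : forall y : Y,
     distribution muXY msnd [set y] = (#|Y|%:R^-1)%:E)
  (eps : R) (eps_ge0 : 0 <= eps)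
  (g : {mfun borel_rV R d >-> borel_rV R n})
  (gXZ : forall x, X x -> Z (g x)) :
  let muX := distribution muXY mfst in
  (1 - ((feature_information muX g - rep_vulnerability X Delta muX eps g)%dE
        + (ln 2)%:E) / (ln #|Y|%:R)%:E
   <= ereal_inf [set adv_risk X Delta muXY eps (h \o g)
                | h in [set: 'rV[R]_n -> Y]])%E.
Proof.
cbv zeta; apply: le_ereal_inf_tmp => _ [h _ <-].
set v := (_ - rep_vulnerability _ _ _ _ _)%dE.
have v0 : (0%:E <= v)%E.
  by apply: le_sub_rep_vulnerability => mu' _; exact: feature_information_ge0.
have ln2 : 0 < ln 2 :> R by rewrite ln_gt0// ltr1n.
have Y0 : (0 < #|Y|)%N by apply/card_gt0P; exists point.
(* With a single label the denominator is 0, whose inverse is [+oo]; the numerator is positive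
   because [v] is nonnegative, so the lower bound is [-oo]. *)
have [Y1|Y1] := eqVneq #|Y| 1%N.
  rewrite Y1 ln1 inve0; case: v v0 => [v| |]// v0.
    by rewrite -EFinD gt0_muley ?leNye// lte_fin ltr_wpDl.
  by rewrite addye// mulyy leNye.
have L0 : 0 < ln #|Y|%:R :> R by rewrite ln_gt0// ltr1n ltn_neqAle eq_sym Y1.
have vr r : (adv_risk X Delta muXY eps (h \o g) < r%:E)%E ->
    (((1 - r) * ln #|Y|%:R - ln 2)%:E <= v)%E.
  move=> advr; apply: le_sub_rep_vulnerability => mu' mu'ball.
  exact: (robust_fano mX Delta_lsc muXY_X muY_unif advr mu'ball).
have : (0 <= adv_risk X Delta muXY eps (h \o g))%E.
  by apply: mu_ext_ge0 => A; exact: measure_ge0.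
case advE : (adv_risk X Delta muXY eps (h \o g)) => [a| |]// _; last exact: leey.
(* [vr] needs [r] strictly above the risk [a]: it is applied to [a + e] for arbitrary positive
   [e]. *)
apply/lee_addgt0Pr => e e0.
have := vr (a + e); rewrite advE lte_fin ltrDl => /(_ e0).
case: v v0 {vr} => [v| |]// v0; last first.
  by rewrite addye// gt0_mulye ?leNye// inver gt_eqF// lte_fin invr_gt0.
rewrite inver gt_eqF//= !lee_fin lerBlDr => h1.
by rewrite lerBlDl -lerBlDr ler_pdivlMr.
Qed.
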